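(* The number of maximal triangle-free graphs with vertex set $[n]=\{1,\dots,n\}$ is at most $2^{n^2/8+o(n^2)}$, where $o(n^2)$ denotes a function $g(n)$ with $g(n)/n^2\to 0$ as $n\to\infty$.
   Context: A graph is triangle-free if it contains no three pairwise adjacent vertices. A triangle-free graph $H$ on vertex set $[n]$ is maximal triangle-free if adding any edge of the complete graph on $[n]$ not already in $H$ creates a triangle. Graphs are counted as labeled graphs on the fixed vertex set $[n]$. *)

(* Defs.v *)
From mathcomp Require Import all_boot.
Set Implicit Arguments. Unset Strict Implicit. Unset Printing Implicit Defensive.

(* A labeled graph on vertex set 'I_n (= [n]) is given by its adjacency
   function on ordered pairs; it is a (simple) graph when the adjacency is
   symmetric and irreflexive.  Each simple graph has exactly one such
   representation, so counting these counts labeled graphs. *)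
Definition graph (n : nat) := {ffun 'I_n * 'I_n -> bool}.

Definition adj n (g : graph n) (i j : 'I_n) : bool := g (i, j).

Definition is_simple n (g : graph n) : bool :=
  [forall i, ~~ adj g i i] && [forall i, forall j, adj g i j == adj g j i].

Definition triangle_free n (g : graph n) : bool :=
  [forall i, forall j, forall k, ~~ [&& adj g i j, adj g j k & adj g i k]].

Definition add_edge n (g : graph n) (a b : 'I_n) : graph n :=
  [ffun p : 'I_n * 'I_n =>
     g p || ((p.1 == a) && (p.2 == b)) || ((p.1 == b) && (p.2 == a))].

Definition maximal_triangle_free n (g : graph n) : bool :=
  [&& is_simple g, triangle_free g &
      [forall a, forall b,
         ((a != b) && ~~ adj g a b) ==> ~~ triangle_free (add_edge g a b)]].

Definition num_mtf (n : nat) : nat :=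
  #|[set g : graph n | maximal_triangle_free g]|.

(* Main.v *)
Require Import Defs.
From mathcomp Require Import all_boot all_order all_algebra.
From mathcomp Require Import zify ring lra.
Set Implicit Arguments. Unset Strict Implicit. Unset Printing Implicit Defensive.
Import Order.TTheory GRing.Theory Num.Theory.

(** A one-sided version of Szemeredi's regularity lemma shows that every triangle-free
    graph H loses at most eps n^2 edges when intersected with some triangle-free graph A
    which is a blow-up of a graph of bounded size; there are 2^(O(n)) such A and
    2^(o(n^2)) choices for S = H \ A.  Given A and S, join two edges of A when
    they form a triangle with an edge of S: this auxiliary graph is triangle-free, and if
    H is maximal then its edges in A form a maximal independent set of it.  By Mantel it
    has at most n^2/4 vertices, and by Hujter and Tuza a triangle-free graph on m vertices
    has at most 2^(m/2) maximal independent sets. *)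

(** * Energy of a partition *)

(** One-sided regularity is enough because finding a triangle across three classes uses only lower
    bounds on the density between large subsets. So a pair has to be split only when it is dense yet
    contains a large sparse subpair, and unequal classes are harmless since each pair is weighted by
    the product of its class sizes. An edge ab of A missing from a maximal H is closed by edges ac,
    bc of H. They are not both in A, and once the edges of A closed by two edges of S are discarded,
    they are not both in S: one lies in A and is a neighbour of ab in the auxiliary graph through
    the other. The exponent is 1/8 = 1/2 * 1/4. To stay within integers, o(n^2) is handled by a
    parameter q: the number s of choices for S satisfies s^q <= 2^(2n^2), the whole count is raised
    to the power 8q, and logarithms enter only at the end, with an error of at most 25n^2/(8q). *)

Section ConditionalExpectation.
Local Open Scope ring_scope.
Variables (F : realFieldType) (W : finType) (u : W -> F).

Definition cexp (D : finType) (phi : W -> D) (w : W) : F :=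
  (\sum_(v | phi v == phi w) u v) / #|[pred v | phi v == phi w]|%:R.

Definition energy (D : finType) (phi : W -> D) : F := \sum_w cexp phi w ^+ 2.

(** Conditional expectation is the orthogonal projection onto functions constant on the fibres of
    [phi]; the two sums already agree on each fibre. *)
Lemma sum_cexpM (D : finType) (phi : W -> D) (h : W -> F) :
  (forall v w, phi v = phi w -> h v = h w) ->
  \sum_w cexp phi w * h w = \sum_w u w * h w.
Proof.
move=> hP; rewrite (partition_big phi predT) //= [RHS](partition_big phi predT) //=.
apply: eq_bigr => d _.
case: (pickP [pred w | phi w == d]) => [w0 /= /eqP w0d | none]; last first.
  by rewrite !big_pred0.
rewrite (eq_bigr (fun=> cexp phi w0 * h w0)); last first.
  move=> w /eqP wd; have ww0 : phi w = phi w0 by rewrite wd w0d.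
  by rewrite (hP _ _ ww0) /cexp ww0.
have N0 : #|[pred v | phi v == d]|%:R != 0 :> F.
  by rewrite pnatr_eq0 -lt0n; apply/card_gt0P; exists w0; rewrite inE w0d.
have -> : \sum_(w | phi w == d) cexp phi w0 * h w0 =
    cexp phi w0 * h w0 * #|[pred v | phi v == d]|%:R.
  by rewrite sumr_const mulr_natr.
rewrite [RHS](eq_bigr (fun w => u w * h w0)); last first.
  by move=> w /eqP wd; rewrite (hP w w0) // wd w0d.
by rewrite -mulr_suml /cexp w0d; field.
Qed.

Lemma sum_cexp_in (D : finType) (phi : W -> D) (P : {set W}) :
  (forall v w, phi v = phi w -> (v \in P) = (w \in P)) ->
  \sum_(w in P) cexp phi w = \sum_(w in P) u w.
Proof.
move=> PP; rewrite big_mkcond [RHS]big_mkcond /=.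
have := @sum_cexpM D phi (fun w => (w \in P)%:R).
have aux g : \sum_w g w * (w \in P)%:R = \sum_w (if w \in P then g w else 0) :> F.
  by apply: eq_bigr => w _; case: ifP => _; rewrite ?mulr1 ?mulr0.
by rewrite !aux; apply=> v w /PP ->.
Qed.

(** Pythagoras: by two uses of [sum_cexpM], the cross term of [cexp psi] and [cexp phi] equals
    [energy phi]. *)
Lemma energy_refine (D D' : finType) (phi : W -> D) (psi : W -> D') :
  (forall v w, psi v = psi w -> phi v = phi w) ->
  energy psi = energy phi + \sum_w (cexp psi w - cexp phi w) ^+ 2.
Proof.
move=> ref.
have cphiE v w : phi v = phi w -> cexp phi v = cexp phi w by rewrite /cexp => ->.
have e1 := sum_cexpM cphiE.
have e2 := @sum_cexpM _ psi (cexp phi) (fun v w e => cphiE _ _ (ref _ _ e)).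
have -> : \sum_w (cexp psi w - cexp phi w) ^+ 2 =
  energy psi - (\sum_w cexp psi w * cexp phi w) *+ 2 + energy phi.
  rewrite /energy -sumrMnl -sumrB -big_split /=; apply: eq_bigr => w _; ring.
rewrite e2 -e1 /energy.
under [\sum_w cexp phi w * cexp phi w]eq_bigr => w _ do rewrite -expr2.
ring.
Qed.

Lemma energy_le (D : finType) (phi : W -> D) : energy phi <= \sum_w u w ^+ 2.
Proof.
have e1 := @sum_cexpM _ phi (cexp phi) _.
have {}e1 : energy phi = \sum_w u w * cexp phi w.
  rewrite /energy -e1; first by apply: eq_bigr => w _; rewrite expr2.
  by rewrite /cexp => v w ->.
have : 0 <= \sum_w (u w - cexp phi w) ^+ 2 by apply: sumr_ge0 => w _; exact: sqr_ge0.
have -> : \sum_w (u w - cexp phi w) ^+ 2 =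
  \sum_w u w ^+ 2 - (\sum_w u w * cexp phi w) *+ 2 + energy phi.
  rewrite /energy -sumrMnl -sumrB -big_split /=; apply: eq_bigr => w _; ring.
rewrite -e1; lra.
Qed.

Lemma deviation_ge (D D' : finType) (phi : W -> D) (psi : W -> D') (P : {set W})
    (a b : F) :
  (forall v w, psi v = psi w -> (v \in P) = (w \in P)) ->
  (forall w, w \in P -> a + b <= cexp phi w) ->
  0 <= a ->
  \sum_(w in P) u w <= b * #|P|%:R ->
  a ^+ 2 * #|P|%:R <= \sum_(w in P) (cexp psi w - cexp phi w) ^+ 2.
Proof.
move=> Ppsi dense a0 sparse.
have := sum_cexp_in Ppsi => eP.
(* Cauchy-Schwarz in tangent form: with d the difference, (d + a)^2 >= 0 bounds d^2 below by an
   expression linear in [cexp psi], whose sum over [P] is that of [u]. *)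
have low : \sum_(w in P) (a * (2 * b + a) - 2 * a * cexp psi w) <=
           \sum_(w in P) (cexp psi w - cexp phi w) ^+ 2.
  apply: ler_sum => w wP; have := dense w wP.
  have := sqr_ge0 (cexp psi w - cexp phi w + a); nra.
apply: le_trans low.
rewrite sumrB sumr_const -mulr_sumr eP -mulr_natr.
nra.
Qed.

End ConditionalExpectation.

(** * One-sided regularity and triangle-free blow-ups *)

Section Regularity.
Local Open Scope ring_scope.

Section LowerRegularity.
Variables (V : finType) (E : rel V) (eps : rat).

Definition edges (A B : {set V}) : {set V * V} := [set p in setX A B | E p.1 p.2].

Definition lower_regular (X Y : {set V}) : bool :=
  [forall A : {set V}, forall B : {set V},
    [&& A \subset X, B \subset Y, eps * #|X|%:R <= #|A|%:R & eps * #|Y|%:R <= #|B|%:R]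
    ==> (eps * (#|A| * #|B|)%:R <= #|edges A B|%:R)].

Lemma lower_regularP (X Y A B : {set V}) :
  lower_regular X Y -> A \subset X -> B \subset Y ->
  eps * #|X|%:R <= #|A|%:R -> eps * #|Y|%:R <= #|B|%:R ->
  eps * (#|A| * #|B|)%:R <= #|edges A B|%:R.
Proof.
move=> /forallP/(_ A)/forallP/(_ B)/implyP reg AX BY lA lB.
by apply: reg; rewrite AX BY lA lB.
Qed.

Lemma lower_regularPn (X Y : {set V}) :
  ~~ lower_regular X Y -> exists P : {set V} * {set V},
    [/\ P.1 \subset X, P.2 \subset Y,
        eps * #|X|%:R <= #|P.1|%:R, eps * #|Y|%:R <= #|P.2|%:R &
        #|edges P.1 P.2|%:R <= eps * (#|P.1| * #|P.2|)%:R].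
Proof.
rewrite negb_forall => /existsP[A]; rewrite negb_forall => /existsP[B].
rewrite negb_imply => /andP[/and4P[AX BY lA lB]]; rewrite -ltNge => /ltW lt.
by exists (A, B).
Qed.

Lemma card_edges (A B : {set V}) :
  #|edges A B|%:R = \sum_(p in setX A B) (E p.1 p.2)%:R :> rat.
Proof.
rewrite -sum1_card natr_sum big_mkcond [RHS]big_mkcond; apply: eq_bigr => p _ /=.
by rewrite inE; case: (p \in _) (E _ _) => [] [].
Qed.

Lemma edges_le (A B : {set V}) : (#|edges A B| <= #|A| * #|B|)%N.
Proof.
by rewrite -cardsX; apply: subset_leq_card; apply/subsetP => p; rewrite inE => /andP[].
Qed.

Definition fib (C : finType) (f : V -> C) (c : C) : {set V} := [set x | f x == c].

Definition pairmap (C : finType) (f : V -> C) (p : V * V) : C * C := (f p.1, f p.2).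

Lemma sum_card_fib (C : finType) (f : V -> C) :
  (\sum_(c : C * C) #|fib f c.1| * #|fib f c.2| = #|V| * #|V|)%N.
Proof.
rewrite -card_prod -sum1_card (partition_big (pairmap f) predT) //=.
apply: eq_bigr => -[c d] _; rewrite -cardsX -sum1_card; apply: eq_bigl => p.
by rewrite !inE.
Qed.

Definition pair_energy (C : finType) (f : V -> C) : rat :=
  energy (fun p : V * V => (E p.1 p.2)%:R) (pairmap f).

(** The density threshold 2 eps leaves a gap of eps above the witness of irregularity, which is what
    raises the energy; sparser pairs carry few edges and are simply discarded later. *)
Definition irregular (C : finType) (f : V -> C) : {set C * C} :=
  [set c | ~~ lower_regular (fib f c.1) (fib f c.2) &
           2%:R * eps * (#|fib f c.1| * #|fib f c.2|)%:R
             <= #|edges (fib f c.1) (fib f c.2)|%:R].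

Hypothesis eps_gt0 : 0 < eps.

(** Splitting along the witnesses gains eps^2 |A||B| on each irregular pair, where |A||B| is at
    least eps^2 times the weight of the pair; the irregular pairs weigh at least eps |V|^2, hence
    eps^5. *)
Lemma energy_increment (C : finType) (f : V -> C) :
  eps * (#|V| * #|V|)%:R <=
    (\sum_(c in irregular f) #|fib f c.1| * #|fib f c.2|)%:R ->
  exists f' : V -> C * {ffun C -> bool} * {ffun C -> bool},
    pair_energy f + eps ^+ 5 * (#|V| * #|V|)%:R <= pair_energy f'.
Proof.
move=> irr.
have wit (c : C * C) : exists P : {set V} * {set V}, c \in irregular f ->
    [/\ P.1 \subset fib f c.1, P.2 \subset fib f c.2,
        eps * #|fib f c.1|%:R <= #|P.1|%:R, eps * #|fib f c.2|%:R <= #|P.2|%:R &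
        #|edges P.1 P.2|%:R <= eps * (#|P.1| * #|P.2|)%:R].
  case: (boolP (c \in irregular f)); last by exists (set0, set0).
  by rewrite inE => /andP[/lower_regularPn[P PP] _]; exists P.
have [P PP] := fin_all_exists wit.
(* A vertex records only the witnesses of pairs that involve its own class: two bits per class, so
   the number of new colours depends on #|C| alone. *)
pose f' v := (f v, [ffun c => v \in (P (f v, c)).1], [ffun c => v \in (P (c, f v)).2]).
exists f'; rewrite /pair_energy (@energy_refine _ _ _ _ _ (pairmap f) (pairmap f')); last first.
  by rewrite /pairmap /f' => -[x y] [x' y'] /= [-> _ _ -> _ _].
rewrite lerD2l; pose u (p : V * V) : rat := (E p.1 p.2)%:R.
pose dev (w : V * V) := (cexp u (pairmap f') w - cexp u (pairmap f) w) ^+ 2.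
rewrite -/u -[leRHS]/(\sum_w dev w).
have dev0 w : 0 <= dev w by apply: sqr_ge0.
rewrite (partition_big (pairmap f) predT) //=.
apply: (@le_trans _ _ (\sum_(c in irregular f)
          eps ^+ 4 * (#|fib f c.1| * #|fib f c.2|)%:R)).
  rewrite -mulr_sumr -natr_sum exprSr -mulrA ler_wpM2l //.
  by rewrite exprn_ge0 // ltW.
rewrite [leRHS](bigID (mem (irregular f))) /=.
rewrite -[leLHS]addr0 lerD //; last by do 2![apply: sumr_ge0 => ? _].
apply: ler_sum => -[c d] irrc.
have [/= Ac Bd lA lB sp] := PP _ irrc.
move: irrc; rewrite inE => /andP[_] /= dense.
set A := (P (c, d)).1 in Ac lA sp *; set B := (P (c, d)).2 in Bd lB sp *.
have inAB w : w \in setX A B -> pairmap f w = (c, d).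
  rewrite !inE => /andP[/(subsetP Ac)]; rewrite inE => /eqP wc.
  by move=> /(subsetP Bd); rewrite inE /pairmap wc => /eqP ->.
apply: (@le_trans _ _ (\sum_(w in setX A B) dev w)); last first.
  rewrite big_mkcond [leRHS]big_mkcond /=; apply: ler_sum => w _.
  by case: ifP => [/inAB ->|_]; rewrite ?eqxx //; case: ifP.
have key : eps ^+ 2 * #|setX A B|%:R <= \sum_(w in setX A B) dev w.
  apply: (@deviation_ge _ _ _ _ _ _ _ _ _ eps) => //.
  - rewrite /pairmap /f' => -[x y] [x' y'] /= [fx e1 _ fy _ e2]; rewrite !inE /=.
    have := congr1 (fun g : {ffun C -> bool} => g d) e1; rewrite !ffunE fx.
    have := congr1 (fun g : {ffun C -> bool} => g c) e2; rewrite !ffunE fy.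
    case: (f x' =P c) => [->|xc]; last first.
      have nA z : f z = f x' -> (z \in A) = false.
        by move=> zx; apply/negP => /(subsetP Ac); rewrite inE zx => /eqP.
      by rewrite !nA.
    case: (f y' =P d) => [->|yd]; last first.
      have nB z : f z = f y' -> (z \in B) = false.
        by move=> zy; apply/negP => /(subsetP Bd); rewrite inE zy => /eqP.
      by rewrite !nB ?andbF.
    by move=> -> ->.
  - move=> w wAB; rewrite /cexp (inAB w wAB).
    set S := \sum_(_ | _) _; set N := #|_|.
    have -> : S = #|edges (fib f c) (fib f d)|%:R.
      by rewrite card_edges; apply: eq_bigl => p; rewrite !inE.
    have NE : N = (#|fib f c| * #|fib f d|)%N.
      by rewrite -cardsX; apply: eq_card => p; rewrite !inE.
    have N0 : (0 < N)%N by apply/card_gt0P; exists w; rewrite inE inAB.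
    rewrite ler_pdivlMr ?ltr0n // NE; apply: le_trans dense.
    by rewrite (_ : eps + eps = 2%:R * eps) //; ring.
  - exact: ltW.
  - by rewrite -card_edges cardsX.
apply: le_trans key; rewrite cardsX !natrM.
have e0 := ltW eps_gt0.
have -> : eps ^+ 4 * (#|fib f c|%:R * #|fib f d|%:R) =
   eps ^+ 2 * ((eps * #|fib f c|%:R) * (eps * #|fib f d|%:R)) by ring.
rewrite ler_wpM2l ?sqr_ge0 // ler_pM // mulr_ge0 //.
Qed.

Lemma pair_energy_le (C : finType) (f : V -> C) : pair_energy f <= (#|V| * #|V|)%:R.
Proof.
apply: le_trans (energy_le _ _) _; rewrite -card_prod -sum1_card natr_sum.
by apply: ler_sum => p _; case: (E _ _); rewrite ?expr1n ?expr0n.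
Qed.

Lemma pair_energy_ge0 (C : finType) (f : V -> C) : 0 <= pair_energy f.
Proof. by apply: sumr_ge0 => w _; apply: sqr_ge0. Qed.

End LowerRegularity.

(** After [k] rounds of refinement, either some round stopped or each one gained eps^5 |V|^2. The
    class bound is iterated along with [k], so it does not depend on the graph. *)
Lemma regularity_or_energy (eps : rat) (k : nat) : 0 < eps ->
  exists K : nat, forall (V : finType) (E : rel V),
    exists (C : finType) (f : V -> C), (#|C| <= K)%N /\
      ((\sum_(c in irregular E eps f) #|fib f c.1| * #|fib f c.2|)%:R
           <= eps * (#|V| * #|V|)%:R \/
       k%:R * eps ^+ 5 * (#|V| * #|V|)%:R <= pair_energy E f).
Proof.
move=> eps0; elim: k => [|k [K IH]].
  exists 1%N => V E; exists unit, (fun=> tt); rewrite card_unit; split=> //.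
  by right; rewrite !mul0r pair_energy_ge0.
exists (K * 2 ^ K * 2 ^ K)%N => V E; have [C [f [CK []]]] := IH V E.
  move=> reg; exists C, f; split; last by left.
  by rewrite -mulnA (leq_trans CK) // leq_pmulr // muln_gt0 expn_gt0.
move=> en; case: (leP (\sum_(c in irregular E eps f) #|fib f c.1| * #|fib f c.2|)%:R
                   (eps * (#|V| * #|V|)%:R)) => [reg|/ltW irr].
  exists C, f; split; last by left.
  by rewrite -mulnA (leq_trans CK) // leq_pmulr // muln_gt0 expn_gt0.
have [f' f'P] := energy_increment eps0 irr.
exists (C * {ffun C -> bool} * {ffun C -> bool})%type, f'; split.
  by rewrite !card_prod card_ffun card_bool !leq_mul // leq_pexp2l.
right; apply: le_trans f'P; rewrite -natr1 mulrDl mul1r mulrDl.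
by rewrite lerD2r.
Qed.

Lemma weak_regularity (eps : rat) : 0 < eps ->
  exists K : nat, forall (V : finType) (E : rel V),
    exists (C : finType) (f : V -> C), (#|C| <= K)%N /\
      (\sum_(c in irregular E eps f) #|fib f c.1| * #|fib f c.2|)%:R
           <= eps * (#|V| * #|V|)%:R.
Proof.
move=> eps0; pose k := Num.truncn (eps ^- 5).
have [K KP] := regularity_or_energy k.+1 eps0.
exists K => V E; have [C [f [CK [reg|en]]]] := KP V E; exists C, f; split=> //.
have : k.+1%:R * eps ^+ 5 * (#|V| * #|V|)%:R <= (#|V| * #|V|)%:R.
  exact: le_trans en (pair_energy_le _ _).
have big : 1 < k.+1%:R * eps ^+ 5.
  rewrite -ltr_pdivrMr ?exprn_gt0 // div1r.
  by rewrite truncnS_gt.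
(* More than eps^-5 gains would exceed the maximal energy |V|^2; an empty [V] gives no contradiction
   but makes every weight zero. *)
case: (posnP (#|V| * #|V|)%N) => [V0 _|V0].
  rewrite V0 mulr0; rewrite -(sum_card_fib f) in V0.
  rewrite (_ : (\sum_(c in _) _)%N = 0%N) //.
  apply/eqP; rewrite -leqn0 -[leqRHS]V0 big_mkcond /=.
  by apply: leq_sum => c _; case: ifP.
by rewrite ger_pMl ?ltr0n // leNgt big.
Qed.

(* A pair of classes is kept in [R] iff it is lower regular, so three pairwise kept
   classes span a triangle of [E]; lost edges lie in irregular or in sparse pairs. *)
Lemma triangle_free_blowup (eps : rat) : 0 < eps -> eps <= 3%:R^-1 ->
  exists K : nat, forall (V : finType) (E : rel V),
    symmetric E -> (forall x y z, E x y -> E y z -> ~~ E x z) ->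
    exists (f : V -> 'I_K) (R : {set 'I_K * 'I_K}),
      let A x y := (f x, f y) \in R in
      [/\ symmetric A, forall x y z, A x y -> A y z -> ~~ A x z &
          #|[set p : V * V | E p.1 p.2 & ~~ A p.1 p.2]|%:R
             <= 3%:R * eps * (#|V| * #|V|)%:R].
Proof.
move=> eps0 eps3; have [K KP] := weak_regularity eps0.
exists K => V E Esym Etf; have [C [f [CK irr]]] := KP V E.
pose good (c d : C) := lower_regular E eps (fib f c) (fib f d).
have edgesC (A B : {set V}) : #|edges E A B| = #|edges E B A|.
  have swapI : injective (fun p : V * V => (p.2, p.1)) by move=> [? ?] [? ?] [-> ->].
  rewrite -(card_imset _ swapI); apply: eq_card => -[a b].
  apply/imsetP/idP => [[[x y]]|].
    by rewrite !inE /= => /andP[/andP[xA yB] xy] [-> ->]; rewrite xA yB Esym.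
  by rewrite !inE /= => /andP[/andP[aB bA] ab]; exists (b, a); rewrite // !inE /= aB bA Esym.
have goodC c d : good c d -> good d c.
  move=> cd; apply/forallP => A; apply/forallP => B; apply/implyP => /and4P[*].
  by rewrite edgesC mulnC; apply: lower_regularP cd _ _ _ _.
pose Ag x y := good (f x) (f y).
have Agtf x y z : Ag x y -> Ag y z -> ~~ Ag x z.
  move=> xy yz; apply/negP => xz.
  (* The vertices in the class of [x] with few neighbours in [Y]. Together with [Y] they span
     density below eps, so lower regularity forces them to be fewer than an eps fraction. *)
  pose lo (Y : {set V}) := [set v in fib f (f x) | #|[set w in Y | E v w]|%:R < eps * #|Y|%:R].
  have X0 : (0 < #|fib f (f x)|)%N by apply/card_gt0P; exists x; rewrite inE.
  have lo_small y' : Ag x y' -> #|lo (fib f (f y'))|%:R < eps * #|fib f (f x)|%:R.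
    move=> xy'; set Y := fib f (f y'); rewrite ltNge; apply/negP => big.
    have Y1 : eps * #|Y|%:R <= #|Y|%:R.
      by rewrite ler_piMl ?ler0n // (le_trans eps3) // lra.
    have lX : lo Y \subset fib f (f x) by apply/subsetP => v; rewrite inE => /andP[].
    have := lower_regularP xy' lX (subxx _) big Y1.
    apply/negP; rewrite -ltNge.
    have lo0 : (0 < #|lo Y|)%N.
      rewrite -(ltr0n rat); apply: lt_le_trans big; rewrite mulr_gt0 ?ltr0n //.
    rewrite card_edges.
    have -> : \sum_(p in setX (lo Y) Y) (E p.1 p.2)%:R =
       \sum_(v in lo Y) #|[set w in Y | E v w]|%:R :> rat.
      rewrite (eq_bigl (fun p : V * V => (p.1 \in lo Y) && (p.2 \in Y))); last first.
        by move=> p; rewrite inE.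
      rewrite -(pair_big_dep (mem (lo Y)) (fun _ => mem Y) (fun v w => (E v w)%:R)) /=.
      apply: eq_bigr => v _; rewrite -sum1_card natr_sum big_mkcond [RHS]big_mkcond.
      by apply: eq_bigr => w _; rewrite inE; case: (w \in Y) (E v w) => [] [].
    have -> : eps * (#|lo Y| * #|Y|)%:R = \sum_(v in lo Y) eps * #|Y|%:R.
      by rewrite sumr_const -mulr_natr natrM; ring.
    case/card_gt0P: lo0 => v0 v0lo.
    rewrite (bigD1 v0) //= [ltRHS](bigD1 v0) //= ltr_leD //.
      by move: v0lo; rewrite inE => /andP[].
    by apply: ler_sum => v /andP[]; rewrite inE => /andP[_ /ltW].
  have := lo_small _ xy; have := lo_small _ xz.
  set LZ := lo _; set LY := lo _ => LZs LYs.
  (* Two exceptional sets cover less than 2 eps <= 2/3 of the class. The remaining [v] has large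
     neighbourhoods in the other two classes, and an edge between these closes a triangle. *)
  have [v vX vL] : exists2 v, v \in fib f (f x) & v \notin LZ :|: LY.
    apply/exists_inP; rewrite -negb_forall_in; apply/negP => /forall_inP sub.
    have : (#|fib f (f x)| <= #|LZ| + #|LY|)%N.
      rewrite (leq_trans _ (leq_card_setU _ _)) // subset_leq_card //.
      exact/subsetP.
    rewrite -(ler_nat rat) natrD => le.
    have : (0 : rat) < #|fib f (f x)|%:R by rewrite ltr0n.
    nra.
  move: vL (vX); rewrite !inE => + vX'; rewrite vX' /= negb_or -!leNgt => /andP[vZ vY].
  have := @lower_regularP _ _ _ _ _ [set w in fib f (f y) | E v w]
      [set w in fib f (f z) | E v w] yz _ _ vY vZ.
  have sub c : [set w in fib f c | E v w] \subset fib f c.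
    by apply/subsetP => w; rewrite inE => /andP[].
  move=> /(_ (sub _) (sub _)); set B := [set w in _ | _]; set D := [set w in _ | _] => le.
  have B0 : (0 < #|B|)%N.
    rewrite -(ltr0n rat); apply: lt_le_trans vY; rewrite mulr_gt0 // ltr0n.
    by apply/card_gt0P; exists y; rewrite inE.
  have D0 : (0 < #|D|)%N.
    rewrite -(ltr0n rat); apply: lt_le_trans vZ; rewrite mulr_gt0 // ltr0n.
    by apply/card_gt0P; exists z; rewrite inE.
  have : (0 < #|edges E B D|)%N.
    rewrite -(ltr0n rat); apply: lt_le_trans le; rewrite mulr_gt0 // ltr0n.
    by rewrite muln_gt0 B0.
  case/card_gt0P => -[b d]; rewrite !inE => /andP[/andP[/andP[_ vb] /andP[_ vd]] /= bd].
  by have := Etf _ _ _ vb bd; rewrite vd.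
(* Colours become ordinals below [K], so that blow-ups range over a type that can be counted. *)
pose g x : 'I_K := widen_ord CK (enum_rank (f x)).
have gP x y : g x = g y -> f x = f y.
  by move=> /(congr1 val)/= /ord_inj/enum_rank_inj.
pose R := [set p : 'I_K * 'I_K | [exists x, exists y, [&& g x == p.1, g y == p.2 & Ag x y]]].
have RE x y : ((g x, g y) \in R) = Ag x y.
  rewrite inE; apply/existsP/idP => [[x' /existsP[y']]|xy].
    by move=> /and3P[/eqP/gP xx /eqP/gP yy]; rewrite /Ag xx yy.
  by exists x; apply/existsP; exists y; rewrite !eqxx.
exists g, R => /=; split.
- by move=> x y; rewrite !RE; apply/idP/idP; apply: goodC.
- by move=> x y z; rewrite !RE; apply: Agtf.
set S := [set p | _].
have cardS : #|S| = (\sum_(c : C * C) #|[set p in S | pairmap f p == c]|)%N.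
  rewrite -sum1_card (partition_big (pairmap f) predT) //=.
  apply: eq_bigr => c _; rewrite -sum1_card; apply: eq_bigl => p.
  by rewrite [RHS]inE.
(* Lower regular pairs lose nothing, sparse pairs at most 2 eps of their weight, and irregular pairs
   are charged in full: 3 eps altogether. *)
have bound c : (#|[set p in S | pairmap f p == c]|%:R : rat) <=
    2%:R * eps * (#|fib f c.1| * #|fib f c.2|)%:R +
    (if c \in irregular E eps f then #|fib f c.1| * #|fib f c.2| else 0)%N%:R.
  have sub : [set p in S | pairmap f p == c] \subset edges E (fib f c.1) (fib f c.2).
    apply/subsetP => p; rewrite !inE => /andP[/andP[-> _] /eqP <-].
    by rewrite !eqxx.
  have le1 := subset_leq_card sub.
  have pos : 0 <= 2%:R * eps * (#|fib f c.1| * #|fib f c.2|)%:R.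
    by rewrite !mulr_ge0 // ltW.
  case: ifP => [_|].
    rewrite -[leLHS]add0r lerD // ler_nat (leq_trans le1) //; exact: edges_le.
  rewrite addr0 inE; case: (boolP (lower_regular _ _ _ _)) => /= [reg _|_].
    rewrite (_ : [set p in S | _] = set0) ?cards0 //.
    apply/setP => p; rewrite in_set0 2!inE RE /Ag; apply/negbTE/negP => /andP[/andP[_ nr] /eqP pc].
    by move: reg nr; rewrite -pc /good /= => ->.
  move/negbT; rewrite -ltNge => /ltW; apply: le_trans.
  by rewrite ler_nat.
rewrite cardS natr_sum; apply: le_trans (ler_sum _ (fun c _ => bound c)) _.
rewrite big_split /= -mulr_sumr -!natr_sum sum_card_fib.
rewrite -big_mkcond /=.
have -> : 3%:R * eps * (#|V| * #|V|)%:R =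
   2%:R * eps * (#|V| * #|V|)%:R + eps * (#|V| * #|V|)%:R :> rat by ring.
by rewrite lerD2l.
Qed.

End Regularity.

(** * Maximal independent sets of triangle-free graphs *)

Section MaximalIndependentSets.
Variables (W : finType) (e : rel W).

(** Relative to a vertex set [U], so that the recursion deletes vertices while [e] stays fixed. *)
Definition mis (U I : {set W}) : bool :=
  [&& I \subset U,
      [forall x in I, forall y in I, ~~ e x y] &
      [forall x in U, (x \in I) || [exists y in I, e x y]]].

Definition num_mis (U : {set W}) : nat := #|[set I | mis U I]|.

Definition cnbhd (U : {set W}) (x : W) : {set W} := [set y in U | (y == x) || e x y].

(* An integer majorant of [2 * 2^(m/2)]; for odd m any coefficient between 8/3 and 3
   satisfies the recursive inequalities of [num_mis_le]. *)
Definition ht_bound (m : nat) : nat := (2 + odd m) * 2 ^ m./2.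

Lemma ht_boundSS m : ht_bound m.+2 = 2 * ht_bound m.
Proof. by rewrite /ht_bound /= negbK expnS; lia. Qed.

Lemma ht_boundS m : ht_bound m <= ht_bound m.+1 /\ 2 * ht_bound m.+1 <= 3 * ht_bound m.
Proof.
elim/ltn_ind: m => -[|[|m]] IH //.
by have := IH m (leqnSn _); rewrite !ht_boundSS; lia.
Qed.

Lemma ht_bound_mono m n : m <= n -> ht_bound m <= ht_bound n.
Proof.
by apply: (homo_leq (fun _ => leqnn _) leq_trans) => k; case: (ht_boundS k).
Qed.

Lemma misP (U I : {set W}) :
  reflect [/\ I \subset U, {in I &, forall x y, ~~ e x y} &
             {in U, forall x, x \in I \/ exists2 y, y \in I & e x y}] (mis U I).
Proof.
apply: (iffP and3P) => -[IU ind dom]; split=> //.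
- by move=> x y xI yI; move/forall_inP/(_ x xI)/forall_inP: ind; apply.
- move=> x xU; move/forall_inP/(_ x xU): dom => /orP[->|/exists_inP]; first by left.
  by case=> y; right; exists y.
- by apply/forall_inP => x xI; apply/forall_inP => y yI; apply: ind.
- apply/forall_inP => x xU; case: (dom x xU) => [->//|[y yI xy]].
  by apply/orP; right; apply/exists_inP; exists y.
Qed.

Hypothesis esym : symmetric e.
Hypothesis eirr : irreflexive e.

Lemma num_mis_with (U : {set W}) x :
  x \in U -> #|[set I | mis U I & x \in I]| <= num_mis (U :\: cnbhd U x).
Proof.
move=> xU; rewrite -(card_in_imset (f := fun I => I :\ x)); last first.
  move=> I J; rewrite !inE => /andP[_ xI] /andP[_ xJ] eIJ.
  by rewrite -(setD1K xI) -(setD1K xJ) eIJ.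
apply: subset_leq_card; apply/subsetP => J /imsetP[I].
rewrite inE => /andP[/misP[IU ind dom] xI] ->{J}; rewrite inE.
apply/misP; split.
- apply/subsetP => y; rewrite !inE => /andP[yx yI].
  by rewrite (subsetP IU) //= (negbTE yx) (negbTE (ind _ _ xI yI)).
- by move=> y z /setD1P[_ yI] /setD1P[_ zI]; apply: ind.
- move=> y; rewrite !inE => /andP[yN yU].
  move: yN; rewrite yU /= negb_or => /andP[yx nxy]; rewrite yx /=.
  case: (dom y yU) => [->|[z zI yz]]; first by left.
  right; exists z => //; rewrite !inE zI andbT.
  by apply/eqP => zx; rewrite zx esym (negbTE nxy) in yz.
Qed.

Lemma num_mis_without (U : {set W}) x :
  #|[set I | mis U I & x \notin I]| <= num_mis (U :\ x).
Proof.
apply: subset_leq_card; apply/subsetP => I; rewrite !inE => /andP[/misP[IU ind dom] xI].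
apply/misP; split=> //; first by rewrite subsetD1 IU.
by move=> y /setD1P[_ /dom].
Qed.

Lemma num_mis_branch (U : {set W}) x : x \in U ->
  num_mis U <= num_mis (U :\ x) + num_mis (U :\: cnbhd U x).
Proof.
move=> xU; rewrite addnC.
apply: leq_trans (leq_add (num_mis_with xU) (num_mis_without U x)).
rewrite /num_mis -(cardsID [set I : {set W} | x \in I]).
by apply: leq_add; apply: subset_leq_card; apply/subsetP => I; rewrite !inE // andbC.
Qed.

(** By maximality at [x], every maximal independent set meets the closed neighbourhood of [x]; then
    a union bound. *)
Lemma num_mis_dominated (U : {set W}) x : x \in U ->
  num_mis U <= \sum_(y in cnbhd U x) num_mis (U :\: cnbhd U y).
Proof.
move=> xU.
have : \sum_(y in cnbhd U x) #|[set I | mis U I & y \in I]| <=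
       \sum_(y in cnbhd U x) num_mis (U :\: cnbhd U y).
  by apply: leq_sum => y; rewrite inE => /andP[yU _]; apply: num_mis_with.
apply: leq_trans.
rewrite /num_mis.
have -> : [set I | mis U I] =
    \bigcup_(y in cnbhd U x) [set I | mis U I & y \in I].
  apply/setP => I; rewrite inE; apply/idP/bigcupP; last first.
    by case=> y _; rewrite inE => /andP[].
  move=> mI; case/misP: (mI) => IU _ /(_ x xU)[xI|[y yI xy]].
    by exists x; rewrite !inE ?xU ?eqxx // mI xI.
  by exists y; rewrite !inE ?(subsetP IU) ?xy ?orbT // mI yI.
elim/big_rec2: _ => [|y m A _ IH]; first by rewrite cards0.
apply: leq_trans (leq_add (leqnn _) IH).
by rewrite cardsU leq_subr.
Qed.

Hypothesis etf : forall x y z, e x y -> e y z -> ~~ e x z.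

Lemma card_setD_cnbhd (U : {set W}) x : #|U :\: cnbhd U x| = #|U| - #|cnbhd U x|.
Proof. by rewrite cardsDS //; apply/subsetP => y; rewrite inE => /andP[]. Qed.

(* Hujter-Tuza: with [T m] the bound, the three branchings need
   [T (m-1) + T (m-4) <= T m], [2 * T (m-2) <= T m] and [2 * T (m-3) + T (m-4) <= T m]. *)
Theorem num_mis_le (U : {set W}) : 2 * num_mis U <= ht_bound #|U|.
Proof.
elim/ltn_ind: {U}#|U| {-2}U (leqnn #|U|) => m IH U Um.
have {}IH (V : {set W}) : V \proper U -> 2 * num_mis V <= ht_bound #|V|.
  by move=> VU; apply: (IH #|V|) => //; apply: leq_trans Um; exact: proper_card.
have self x : x \in U -> x \in cnbhd U x by move=> xU; rewrite !inE xU eqxx.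
have IHD x k (V : {set W}) : x \in V -> V \subset U -> k <= #|cnbhd V x| ->
    2 * num_mis (V :\: cnbhd V x) <= ht_bound (#|V| - k).
  move=> xV VU kN; apply: leq_trans (IH _ _) _.
    apply/properP; split; first exact: subset_trans (subsetDl _ _) VU.
    by exists x; [exact: (subsetP VU) | rewrite !inE xV eqxx].
  by rewrite card_setD_cnbhd; apply/ht_bound_mono/leq_sub2l.
(* These give T (k-1) = 2 * T (k-3) <= 3 * T (k-4) and T k = 4 * T (k-4), so the first and third
   branchings both come down to 3 + 1 = 4. *)
have H4 k : 4 <= k -> ht_bound k = 4 * ht_bound (k - 4) /\
   2 * ht_bound (k - 3) <= 3 * ht_bound (k - 4) /\ ht_bound (k - 1) = 2 * ht_bound (k - 3).
  case: k => [|[|[|[|k]]]] // _; rewrite !subSS !subn0 !ht_boundSS.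
  by case: (ht_boundS k); lia.
case: (set_0Vmem U) => [->|[v0 v0U]].
  rewrite cards0 /ht_bound /= muln1 /num_mis.
  have -> : [set I | mis set0 I] = [set set0].
    apply/setP => I; rewrite !inE; apply/idP/eqP => [/and3P[]|->].
      by rewrite subset0 => /eqP.
    by apply/misP; split=> // x; rewrite inE.
  by rewrite cards1.
have U0 : 0 < #|U| by apply/card_gt0P; exists v0.
case: (boolP [exists x in U, 4 <= #|cnbhd U x|]) => [/exists_inP[x xU x4]|].
  have := num_mis_branch xU.
  have := IHD x 4 U xU (subxx _) x4.
  have := IH (U :\ x) (properD1 xU).
  have -> : #|U :\ x| = #|U| - 1 by rewrite (cardsD1 x U) xU; lia.
  have U4 : 4 <= #|U|.
    apply: leq_trans x4 _; apply: subset_leq_card.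
    by apply/subsetP => y; rewrite inE => /andP[].
  have := H4 _ U4; lia.
move/exists_inPn => deg2; have {}deg2 x : x \in U -> #|cnbhd U x| <= 3.
  by move=> /deg2; rewrite -leqNgt.
case: (boolP [exists x in U, #|cnbhd U x| <= 2]) => [/exists_inP[x xU x2]|].
  have sum2 := num_mis_dominated xU.
  (* Here [x] has degree at most one; a neighbour [y] has a closed neighbourhood at least as large,
     so every term deletes at least as many vertices as [x] would. *)
  have bnd y : y \in cnbhd U x ->
     2 * num_mis (U :\: cnbhd U y) <= ht_bound (#|U| - #|cnbhd U x|).
    rewrite !inE => /andP[yU /orP[/eqP->|xy]]; first by apply: (IHD _ _ U).
    apply: (IHD _ _ U) => //; apply: leq_trans x2 _.
    have -> : 2 = #|[set x; y]|.
      by rewrite cards2; case: eqP => // exy; rewrite exy eirr in xy.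
    apply: subset_leq_card; apply/subsetP => z; rewrite !inE => /orP[]/eqP ->.
      by rewrite xU esym xy orbT.
    by rewrite yU eqxx.
  have {bnd}: \sum_(y in cnbhd U x) (2 * num_mis (U :\: cnbhd U y)) <=
     #|cnbhd U x| * ht_bound (#|U| - #|cnbhd U x|).
    by rewrite -sum_nat_const; apply: leq_sum.
  rewrite -big_distrr /=.
  have N1 : 0 < #|cnbhd U x| by apply/card_gt0P; exists x; exact: self.
  have NU : #|cnbhd U x| <= #|U|.
    by apply: subset_leq_card; apply/subsetP => y; rewrite inE => /andP[].
  have [N2|N2] : #|cnbhd U x| = 1 \/ #|cnbhd U x| = 2 by lia.
    rewrite N2; have := ht_bound_mono (leq_subr 1 #|U|); lia.
  rewrite N2 in NU *; have -> : ht_bound #|U| = 2 * ht_bound (#|U| - 2).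
    by rewrite -ht_boundSS; congr ht_bound; lia.
  lia.
move/exists_inPn => deg2'; have {}deg2' x : x \in U -> #|cnbhd U x| = 3.
  by move=> xU; have := deg2' x xU; have := deg2 x xU; lia.
(* every vertex has degree two: branch at [v], then at the neighbour [a] of [v],
   whose degree has dropped to one, dominating it by [a] and its other neighbour [c] *)
have nb x : x \in U -> cnbhd U x = x |: [set y in U | e x y].
  by move=> xU; apply/setP => y; rewrite !inE; case: eqP => // ->; rewrite xU.
have nb2 x : x \in U -> #|[set y in U | e x y]| = 2.
  move=> xU; have := deg2' x xU; rewrite nb // cardsU1 inE eirr andbF /=; lia.
have [a] : exists a, a \in [set y in U | e v0 y] by apply/card_gt0P; rewrite nb2.
rewrite inE => /andP[aU va].
have v0a : v0 \in [set y in U | e a y] by rewrite inE v0U esym.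
have [c ac] : exists c, [set y in U | e a y] :\ v0 = [set c].
  by apply/cards1P; have := nb2 a aU; rewrite (cardsD1 v0) v0a; case: #|_| => [|[]].
have : c \in [set y in U | e a y] :\ v0 by rewrite ac set11.
rewrite !inE => /and3P[cv cU eac].
set U' := U :\ v0.
have U'U : U' \subset U by apply: subsetDl.
have av : a != v0 by apply/eqP => av; rewrite av eirr in va.
have aU' : a \in U' by rewrite !inE av.
have cU' : c \in U' by rewrite !inE cv.
have Na : cnbhd U' a = [set a; c].
  apply/setP => y; rewrite !inE.
  have := congr1 (fun s : {set W} => y \in s) ac; rewrite !inE.
  case: (y =P a) => [->|_] /=; first by rewrite aU av.
  by rewrite -andbA.
(* Triangle-freeness enters here: [v0] and [c] share the neighbour [a], so they are not adjacent and
   [c] keeps degree two after [v0] is deleted. *)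
have Nc : cnbhd U' c = cnbhd U c.
  apply/setP => y; rewrite !inE; case: eqP => //= ->.
  by rewrite eq_sym (negbTE cv) esym (negbTE (etf va eac)) andbF.
have U4 : 4 <= #|U|.
  have /subset_leq_card : v0 |: cnbhd U' c \subset U.
    rewrite subUset sub1set v0U Nc /=.
    by apply/subsetP => y; rewrite inE => /andP[].
  by rewrite cardsU1 Nc deg2' // -Nc !inE eqxx.
have cU1 : #|U'| = #|U| - 1 by rewrite /U' [in RHS](cardsD1 v0 U) v0U addKn.
have n1 := num_mis_branch v0U; rewrite -/U' in n1.
have b1 := IHD v0 3 U v0U (subxx _); rewrite deg2' // in b1.
have n2 := num_mis_dominated aU'.
have ca : a != c by apply/eqP => ac'; rewrite ac' eirr in eac.
rewrite Na big_setU1 ?inE //= big_set1 in n2.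
have b2 := IHD a 2 U' aU' U'U; rewrite Na cards2 ca in b2.
have b3 := IHD c 3 U' cU' U'U; rewrite Nc deg2' // in b3.
move: (b1 isT) (b2 isT) (b3 isT) n1 n2 (H4 _ U4).
by rewrite Na Nc cU1 -!subnDA !add1n; clear; lia.
Qed.

End MaximalIndependentSets.

(** * Graphs with prescribed edges outside a triangle-free graph *)

Section Mantel.
Variables (V : finType) (A : rel V).
Hypothesis Asym : symmetric A.
Hypothesis Atf : forall x y z, A x y -> A y z -> ~~ A x z.

(** Each edge is counted in both orientations. Summing d x + d y <= |V| over these pairs bounds the
    sum of squared degrees from above; Cauchy-Schwarz bounds it from below. *)
Theorem mantel : 2 * #|[set p : V * V | A p.1 p.2]| <= #|V| * #|V|.
Proof.
pose d x := #|[set y | A x y]|.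
have M1 : #|[set p : V * V | A p.1 p.2]| = \sum_x d x.
  rewrite -sum1_card (eq_bigl (fun p : V * V => predT p.1 && A p.1 p.2)); last first.
    by move=> p; rewrite inE.
  rewrite -(pair_big_dep predT A (fun _ _ => 1)) /=.
  by apply: eq_bigr => x _; rewrite /d -sum1_card; apply: eq_bigl => y; rewrite inE.
have dxy x y : A x y -> d x + d y <= #|V|.
  move=> xy; rewrite /d -cardsUI (_ : _ :&: _ = set0) ?cards0 ?addn0 ?max_card //.
  apply/setP => z; rewrite !inE; apply/negbTE/negP => /andP[xz yz].
  by have := Atf xy yz; rewrite xz.
have sq : 2 * \sum_x d x * d x <= #|V| * \sum_x d x.
  have -> : 2 * \sum_x d x * d x = \sum_x \sum_(y | A x y) (d x + d y).
    rewrite mul2n -addnn; under [RHS]eq_bigr do rewrite big_split /=.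
    rewrite big_split /=; congr (_ + _).
      by apply: eq_bigr => x _; rewrite sum_nat_const; congr (_ * _); rewrite /d cardsE.
    rewrite (exchange_big_dep predT) //=; apply: eq_bigr => x _.
    rewrite sum_nat_const; congr (_ * _); rewrite /d cardsE.
    by apply: eq_card => y; rewrite !unfold_in Asym.
  rewrite big_distrr /=; apply: leq_sum => x _.
  rewrite mulnC /d -sum_nat_const.
  rewrite [leqRHS](eq_bigl (A x)); last by move=> y; rewrite inE.
  by apply: leq_sum => y /dxy.
have cs : (\sum_x d x) * (\sum_x d x) <= #|V| * \sum_x d x * d x.
  rewrite -(leq_pmul2l (isT : 0 < 2)).
  have -> : #|V| * \sum_x d x * d x = \sum_(x : V) \sum_y d y * d y.
    by rewrite sum_nat_const.
  have -> : 2 * \sum_(x : V) \sum_y d y * d y = \sum_x \sum_y (d x * d x + d y * d y).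
    under [RHS]eq_bigr do rewrite big_split /=.
    by rewrite big_split /= mul2n -addnn [X in X + _]exchange_big.
  rewrite big_distrlr big_distrr /=; apply: leq_sum => x _.
  rewrite big_distrr /=; apply: leq_sum => y _.
  by have [+ _] := nat_Cauchy (d x) (d y); rewrite -!mulnn.
rewrite M1; move: sq cs; set M := \sum_x d x; set Q := \sum_x _ => sq cs.
case: (posnP M) => [->//|M0].
rewrite -(leq_pmul2l M0); nia.
Qed.

Lemma mantel_oriented (lt : rel V) : (forall x y, lt x y -> ~~ lt y x) ->
  4 * #|[set p : V * V | A p.1 p.2 & lt p.1 p.2]| <= #|V| * #|V|.
Proof.
move=> lt_asym; apply: leq_trans mantel.
rewrite (_ : 4 = 2 * 2) // -mulnA leq_pmul2l //.
set U := [set p | _ & _].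
have dis : [disjoint U & [set (p.2, p.1) | p in U]].
  rewrite -setI_eq0; apply/eqP/setP => -[x y]; rewrite !inE.
  apply/negbTE/negP => /andP[/andP[_ xy]] /imsetP[[x' y']] /=.
  by rewrite inE /= => /andP[_ yx] [ex ey]; move: yx; rewrite -ex -ey => /lt_asym; rewrite xy.
have := leq_card_setU U [set (p.2, p.1) | p in U]; case=> _.
rewrite dis => /eqP; rewrite card_imset; last by move=> [x y] [x' y'] /= [-> ->].
rewrite mul2n -addnn => <-; apply: subset_leq_card; apply/subsetP => -[x y].
rewrite !inE => /orP[/andP[]//|/imsetP[[x' y']]].
by rewrite inE /= => /andP[] ? _ [-> ->]; rewrite Asym.
Qed.

End Mantel.

(** * Maximal graphs with given A and S as maximal independent sets *)

Section Extensions.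
Variables (n : nat) (A S : rel 'I_n).
Hypothesis Asym : symmetric A.
Hypothesis Atf : forall x y z, A x y -> A y z -> ~~ A x z.
Hypothesis Ssym : symmetric S.
Hypothesis Stf : forall x y z, S x y -> S y z -> ~~ S x z.

Notation W := ('I_n * 'I_n)%type.

(** Links read a pair as an unordered edge, whereas [free_edges] keeps its increasing
    representative. *)
Let same (p : W) x y := (p == (x, y)) || (p == (y, x)).

(* With [S] the edges of a graph outside [A], two edges of [A] are linked when some
   edge of [S] completes them to a triangle. *)
Definition linked (p q : W) : bool :=
  [exists x, exists y, exists z, [&& same p x y, same q x z & S y z]].

(* An edge closed by two edges of [S] can never be added, hence the last condition. *)
Definition free_edges : {set W} :=
  [set p | [&& A p.1 p.2, p.1 < p.2 & ~~ [exists z, S p.1 z && S p.2 z]]].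

Lemma linkedP p q :
  reflect (exists x y z, [/\ same p x y, same q x z & S y z]) (linked p q).
Proof.
apply: (iffP existsP) => [[x /existsP[y /existsP[z /and3P[]]]]|[x [y [z [h1 h2 h3]]]]].
  by exists x, y, z.
by exists x; apply/existsP; exists y; apply/existsP; exists z; rewrite h1 h2.
Qed.

Let Airr x : ~~ A x x.
Proof. by apply/negP => xx; have := Atf xx xx; rewrite xx. Qed.

Let Sirr x : ~~ S x x.
Proof. by apply/negP => xx; have := Stf xx xx; rewrite xx. Qed.

Lemma linked_sym : symmetric linked.
Proof.
suff h p q : linked p q -> linked q p by move=> p q; apply/idP/idP; apply: h.
by move=> /linkedP[x [y [z [? ? ?]]]]; apply/linkedP; exists x, z, y; rewrite Ssym.
Qed.

Lemma linked_irr p : ~~ linked p p.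
Proof.
apply/negP => /linkedP[x [y [z [xy xz yz]]]].
have yNz : y != z by apply/eqP => e; rewrite e (negbTE (Sirr z)) in yz.
case/orP: xy => /eqP ep; rewrite ep in xz; case/orP: xz => /eqP[].
- by move=> e; rewrite e eqxx in yNz.
- by move=> e e'; rewrite -e e' eqxx in yNz.
- by move=> e e'; rewrite e -e' eqxx in yNz.
- by move=> e; rewrite e eqxx in yNz.
Qed.

Lemma same_adj (B : rel 'I_n) p x y : symmetric B -> same p x y -> B p.1 p.2 = B x y.
Proof. by move=> Bs /orP[]/eqP ->. Qed.

(* Three pairwise linked edges of [A] would form a star, closed up by a triangle
   of [S], or a triangle of [A]. *)
Lemma linked_tf p q r : A p.1 p.2 -> A q.1 q.2 -> A r.1 r.2 ->
  linked p q -> linked q r -> ~~ linked p r.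
Proof.
move=> Ap Aq Ar /linkedP[x [y [z [pxy qxz Syz]]]] /linkedP[a [b [c [qab rac Sbc]]]].
apply/negP => /linkedP[a' [b' [c' [pab rac' Sbc']]]].
rewrite (same_adj Asym pxy) in Ap; rewrite (same_adj Asym qxz) in Aq.
rewrite (same_adj Asym rac) in Ar.
have S0 v : S v v -> False by apply/negP/Sirr.
have A0 v : A v v -> False by apply/negP/Airr.
have T1 u v w : S u v -> S v w -> S u w -> False by move=> uv vw; apply/negP; apply: Stf uv vw.
have T2 u v w : A u v -> A v w -> A u w -> False by move=> uv vw; apply/negP; apply: Atf uv vw.
(* Reversed copies of all adjacencies let [eauto] find a loop or a triangle of [A] or [S] whatever
   the orientations. *)
move: (Ap) (Aq) (Ar) (Syz) (Sbc) (Sbc').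
rewrite Asym [A x z]Asym [A a c]Asym Ssym [S b c]Ssym [S b' c']Ssym => Ap' Aq' Ar' S1 S2 S3.
case/orP: pxy => /eqP ep; subst p; case/orP: pab => /eqP[] *; subst a' b';
case/orP: qxz => /eqP eq; subst q; case/orP: qab => /eqP[] *; subst a b;
case/orP: rac => /eqP er; subst r; case/orP: rac' => /eqP[] *; subst;
by eauto 5.
Qed.

Definition extends (g : graph n) : bool :=
  maximal_triangle_free g && [forall x, forall y, S x y == adj g x y && ~~ A x y].

Definition trace (g : graph n) : {set W} := [set p in free_edges | g p].

Lemma simpleP (g : graph n) :
  reflect ((forall i, ~~ adj g i i) /\ symmetric (adj g)) (is_simple g).
Proof.
apply: (iffP andP) => -[irr sym]; split.
- exact/forallP.
- by move=> i j; move/forallP/(_ i)/forallP/(_ j)/eqP: sym.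
- exact/forallP.
- by apply/forallP => i; apply/forallP => j; rewrite sym.
Qed.

Lemma triangle_freeP (g : graph n) :
  reflect (forall x y z, adj g x y -> adj g y z -> ~~ adj g x z) (triangle_free g).
Proof.
apply: (iffP idP) => [tf x y z xy yz|tf].
  by move/forallP/(_ x)/forallP/(_ y)/forallP/(_ z): tf; rewrite xy yz.
do 3![apply/forallP => ?]; apply/negP => /and3P[xy yz].
by apply/negP; apply: tf xy yz.
Qed.

Lemma maximal_closed (g : graph n) a b : maximal_triangle_free g ->
  a != b -> ~~ adj g a b -> exists2 c, adj g a c & adj g b c.
Proof.
case/and3P=> /simpleP[irr sym] /triangle_freeP tf /forallP/(_ a)/forallP/(_ b)/implyP max ab nab.
move: max; rewrite ab nab => /(_ isT)/negP max.
case: (pickP [pred c | adj g a c && adj g b c]) => [c /andP[]|nope]; first by exists c.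
case: max; apply/triangle_freeP => x y z.
have none c : adj g a c -> adj g b c -> False by move=> ac bc; have := nope c; rewrite /= ac bc.
have adjE u v : adj (add_edge g a b) u v =
    adj g u v || ((u == a) && (v == b)) || ((u == b) && (v == a)).
  by rewrite /adj ffunE.
rewrite !adjE -!orbA.
(* Each side of the triangle is an old edge or the new one in either orientation; with exactly one
   new side, the opposite vertex is a common neighbour. *)
case/or3P=> [xy|/andP[/eqP ? /eqP ?]|/andP[/eqP ? /eqP ?]]; subst;
case/or3P=> [yz|/andP[/eqP ? /eqP ?]|/andP[/eqP ? /eqP ?]]; subst;
apply/negP; case/or3P=> [xz|/andP[/eqP ? /eqP ?]|/andP[/eqP ? /eqP ?]]; subst;
rewrite ?eqxx // in ab;
try (by move: (irr a) (irr b); rewrite ?xy ?yz ?xz);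
try (by have := tf _ _ _ xy yz; rewrite xz);
try (apply: (none x); rewrite // sym //);
try (apply: (none y); rewrite // sym //);
try (apply: (none z); rewrite // sym //).
Qed.

Lemma trace_mis (g : graph n) : extends g -> mis linked free_edges (trace g).
Proof.
case/andP=> mg /forallP SE; have {}SE x y : S x y = adj g x y && ~~ A x y.
  by move/forallP/(_ y)/eqP: (SE x).
have /and3P[/simpleP[irr sym] /triangle_freeP tf _] := mg.
apply/misP; split.
- by apply/subsetP => p; rewrite inE => /andP[].
- move=> p q; rewrite !inE => /andP[_ gp] /andP[_ gq].
  apply/negP => /linkedP[x [y [z [pxy qxz yz]]]].
  have {}gp : adj g x y by rewrite -(same_adj sym pxy) /adj -surjective_pairing.
  have {}gq : adj g x z by rewrite -(same_adj sym qxz) /adj -surjective_pairing.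
  move: yz; rewrite SE => /andP[yz _].
  by have := tf _ _ _ gp yz; rewrite gq.
- move=> [a b] ab; case: (boolP (adj g a b)) => [gab|nab].
    by left; rewrite inE ab.
  right; move: (ab); rewrite inE => /and3P[/= Aab lt_ab noS].
  have aNb : a != b by rewrite neq_ltn lt_ab.
  have [c ac bc] := maximal_closed mg aNb nab.
  have free (x y : 'I_n) : A x y -> adj g x y -> x < y -> (x, y) \in trace g.
    move=> Axy gxy lt; rewrite !inE /= Axy lt [g _](gxy : g (x, y) = true) andbT /=.
    apply/existsP => -[z /andP[]]; rewrite !SE => /andP[xz _] /andP[yz _].
    by have := tf _ _ _ gxy yz; rewrite xz.
  have free' x y : A x y -> adj g x y -> exists2 q, q \in trace g & same q x y.
    move=> Axy gxy; case: (ltngtP x y) => [lt|lt|e].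
    + by exists (x, y); [apply: free | rewrite /same eqxx].
    + by exists (y, x); [apply: free; rewrite // 1?Asym // sym | rewrite /same eqxx orbT].
    + by move: gxy; rewrite (ord_inj e) (negbTE (irr y)).
  (* Both in [A] is a triangle of [A], both in [S] contradicts freeness, and the mixed cases provide
     the link. *)
  case: (boolP (A a c)) => Aac; case: (boolP (A b c)) => Abc.
  + by have := Atf Aab Abc; rewrite Aac.
  + have [q qT qs] := free' _ _ Aac ac; exists q => //.
    by apply/linkedP; exists a, b, c; rewrite /same eqxx SE bc Abc; split.
  + have [q qT qs] := free' _ _ Abc bc; exists q => //.
    by apply/linkedP; exists b, a, c; rewrite /same eqxx orbT SE ac Aac; split.
  + by case/existsP: noS; exists c; rewrite /= !SE ac bc Aac Abc.
Qed.

(** Outside [A] the graph is [S]; inside [A] its edges are all free, since two edges of [S] closing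
    one would form a triangle of the graph. *)
Lemma trace_inj : {in [set g | extends g] &, injective trace}.
Proof.
move=> g h; rewrite !inE => eg eh e; apply/ffunP.
suff sub g1 g2 : extends g1 -> extends g2 -> trace g1 = trace g2 ->
    forall x y, adj g1 x y -> adj g2 x y.
  by move=> [x y]; apply/idP/idP; apply: sub.
move=> {eg eh e g h} /andP[/and3P[/simpleP[irr1 sym1] /triangle_freeP tf _] /forallP S1].
move=> /andP[/and3P[/simpleP[_ sym2] _ _] /forallP S2] e.
have lt_case (x y : 'I_n) : x < y -> adj g1 x y -> adj g2 x y.
  move=> lt g1xy; have := forallP (S1 x) y; have := forallP (S2 x) y.
  rewrite g1xy; case: (boolP (A x y)) => [Axy _ _|_ /eqP -> /eqP]; last first.
    by rewrite andbT.
  have : (x, y) \in trace g2; last by rewrite inE => /andP[].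
  rewrite -e !inE /= Axy lt; apply/andP; split=> //; apply/existsP => -[z].
  have /eqP -> := forallP (S1 x) z; have /eqP -> := forallP (S1 y) z.
  by move=> /andP[/andP[xz _] /andP[yz _]]; have := tf _ _ _ g1xy yz; rewrite xz.
move=> x y; case: (ltngtP x y) => [|lt|exy]; first exact: lt_case.
  by rewrite sym1 sym2; apply: lt_case.
by rewrite (ord_inj exy) (negbTE (irr1 y)).
Qed.

(* The eighth power keeps the bound 2^(n^2/8 + 1) integral. *)
Lemma card_extends :
  #|[set g | extends g]| ^ 8 <= 2 ^ (n * n + 8).
Proof.
(* [linked] is triangle-free only among edges of [A], while [num_mis_le] wants this on the whole
   type. *)
pose e (p q : W) := [&& linked p q, A p.1 p.2 & A q.1 q.2].
have le1 : #|[set g | extends g]| <= num_mis e free_edges.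
  rewrite -(card_in_imset trace_inj); apply: subset_leq_card.
  apply/subsetP => I /imsetP[g]; rewrite !inE => /trace_mis gm ->.
  case/misP: gm => sub ind dom; apply/misP; split=> //.
    by move=> p q pI qI; rewrite /e (negbTE (ind _ _ pI qI)).
  move=> p pU; case: (dom p pU) => [|[q qI pq]]; [by left|right; exists q => //].
  have := subsetP sub q qI; rewrite /e pq; move: pU; rewrite !inE.
  by move=> /and3P[-> _ _] /and3P[-> _ _].
have le2 : 2 * num_mis e free_edges <= ht_bound #|free_edges|.
  apply: num_mis_le.
  - by move=> p q; rewrite /e linked_sym; congr (_ && _); apply: andbC.
  - by move=> p; rewrite /e (negbTE (linked_irr p)).
  - move=> p q r /and3P[pq Ap Aq] /and3P[qr _ Ar].
    by rewrite /e (negbTE (linked_tf Ap Aq Ar pq qr)).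
have le3 : 4 * #|free_edges| <= n * n.
  have lt_asym (x y : 'I_n) : x < y -> ~~ (y < x) by rewrite -leqNgt => /ltnW.
  have := mantel_oriented Asym Atf lt_asym; rewrite card_ord; apply: leq_trans.
  rewrite leq_pmul2l //; apply: subset_leq_card; apply/subsetP => p.
  by rewrite !inE => /and3P[-> ->].
move: le2; rewrite /ht_bound; set m := #|free_edges| in le3 * => le2.
(* The coefficient 2 or 3 is rounded up to 4. Then 8 * (m./2 + 1) <= 4 * m + 8 <= n * n + 8 by
   Mantel. *)
have {le2} le2 : #|[set g | extends g]| <= 2 ^ (m./2).+1.
  by rewrite expnS; case: (odd m) le2; lia.
apply: (@leq_trans ((2 ^ (m./2).+1) ^ 8)); first by rewrite leq_exp2r.
rewrite -expnM leq_pexp2l //; lia.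
Qed.

End Extensions.

(** * Counting *)

Lemma leq_expn2r m n e : m <= n -> m ^ e <= n ^ e.
Proof. by case: e => // e mn; rewrite leq_exp2r. Qed.

(** Chernoff-style: in the expansion of (1 + M)^|W| over subsets, each set of size at most [m]
    contributes at least M^(|W| - m). *)
Lemma card_small_sets (W : finType) (M m : nat) : 0 < M ->
  #|[set X : {set W} | #|X| <= m]| * M ^ #|W| <= M ^ m * M.+1 ^ #|W|.
Proof.
move=> M0.
have -> : M.+1 ^ #|W| = \sum_(X : {set W}) M ^ (#|W| - #|X|).
  rewrite -(card_ord M.+1).
  have -> : #|'I_M.+1| ^ #|W| = \prod_(w : W) (1 + M).
    by rewrite prod_nat_const card_ord.
  rewrite bigA_distr /=; apply: eq_bigr => X _.
  rewrite (bigID (mem X)) /= big1 ?mul1n; last by move=> w ->.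
  rewrite (eq_bigr (fun=> M)); last by move=> w /negbTE ->.
  by rewrite prod_nat_const -(cardC X) addKn; congr (_ ^ _); apply: eq_card => w; rewrite !inE.
rewrite big_distrr /= (bigID (fun X : {set W} => #|X| <= m)) /=.
apply: leq_trans (leq_addr _ _).
rewrite -sum_nat_const.
rewrite [leqLHS](eq_bigl (fun X : {set W} => #|X| <= m)); last first.
  by move=> X; rewrite inE.
apply: leq_sum => X Xm; rewrite -expnD leq_pexp2l //.
by have := max_card (mem X); lia.
Qed.

(** This is (1 + 1/M)^q (1 - q/M) <= 1 with denominators cleared; truncated subtraction makes it
    trivial for q >= M. *)
Lemma bernoulli (M q : nat) : M.+1 ^ q * (M - q) <= M ^ q * M.
Proof.
elim: q => [|q IH]; first by rewrite !expn0 subn0.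
rewrite !expnS; apply: (@leq_trans (M * (M.+1 ^ q * (M - q)))); last by nia.
have : M.+1 * (M - q.+1) <= M * (M - q) by nia.
move: (M.+1 ^ q) (M - q) (M - q.+1) => a b c; nia.
Qed.

Lemma card_small_sets_root (W : finType) (q m : nat) : 0 < q ->
  q.+1 * q * m <= #|W| ->
  #|[set X : {set W} | #|X| <= m]| ^ q <= 2 ^ (2 * #|W|).
Proof.
(* This [M] is at least 2q, so (M + 1)^q <= 2 M^q, and M^(q m) is 2^((q+1) q m) <= 2^|W|: the two
   factors give 2^(2|W|). *)
move=> q0 mW; pose M := 2 ^ q.+1.
have M0 : 0 < M by rewrite expn_gt0.
have Mq : 2 * q <= M.
  by rewrite /M expnS leq_pmul2l // ltnW // ltn_expl.
have B : M.+1 ^ q <= 2 * M ^ q.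
  have Mq' : M <= 2 * (M - q) by lia.
  have Mq0 : 0 < M - q by lia.
  rewrite -(leq_pmul2r Mq0); apply: leq_trans (bernoulli M q) _.
  by rewrite -mulnA mulnCA leq_mul2l Mq' orbT.
have := card_small_sets W m M0; set s := #|_|; set w := #|W| => S.
have {}S : s ^ q * (M ^ w) ^ q <= (M ^ m) ^ q * (2 ^ w * (M ^ w) ^ q).
  rewrite -expnMn; apply: (@leq_trans ((M ^ m * M.+1 ^ w) ^ q)).
    by rewrite leq_exp2r.
  rewrite expnMn leq_mul2l; apply/orP; right.
  rewrite -!expnM ![w * q]mulnC !expnM -expnMn.
  by rewrite leq_expn2r //.
rewrite mulnA leq_pmul2r ?expn_gt0 ?M0 // in S.
apply: leq_trans S _; rewrite /M -!expnM -expnD leq_pexp2l //; nia.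
Qed.

Definition blowup (n K : nat) (t : {ffun 'I_n -> 'I_K} * {set 'I_K * 'I_K}) : rel 'I_n :=
  fun x y => (t.1 x, t.1 y) \in t.2.

Lemma num_mtf_le (q : nat) : 0 < q ->
  exists K : nat, forall n, exists s : nat,
    s ^ q <= 2 ^ (2 * (n * n)) /\
    num_mtf n ^ 8 <= (K ^ n * 2 ^ (K * K)) ^ 8 * s ^ 8 * 2 ^ (n * n + 8).
Proof.
move=> q0.
(* Chosen so that the loss 3 eps n^2 is n^2/((q+1) q), the size allowed by
   [card_small_sets_root]. *)
pose eps : rat := ((3 * (q.+1 * q))%:R^-1)%R.
have eps0 : (0 < eps)%R by rewrite invr_gt0 ltr0n !muln_gt0 q0.
have eps3 : (eps <= 3%:R^-1)%R.
  by rewrite lef_pV2 ?posrE ?ltr0n ?muln_gt0 ?q0 // ler_nat; nia.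
have [K KP] := triangle_free_blowup eps0 eps3.
exists K => n; pose m := (n * n) %/ (q.+1 * q).
pose Sm := [set X : {set 'I_n * 'I_n} | #|X| <= m].
have cW : #|{: 'I_n * 'I_n}| = n * n by rewrite card_prod card_ord.
exists #|Sm|; split.
  by rewrite -cW; apply: card_small_sets_root => //; rewrite cW mulnC leq_trunc_div.
pose T := ({ffun 'I_n -> 'I_K} * {set 'I_K * 'I_K})%type.
pose Srel (X : {set 'I_n * 'I_n}) : rel 'I_n := fun x y => (x, y) \in X.
pose ok (c : T * {set 'I_n * 'I_n}) :=
  [&& [forall x, forall y, blowup c.1 x y == blowup c.1 y x],
      [forall x, forall y, forall z, ~~ [&& blowup c.1 x y, blowup c.1 y z & blowup c.1 x z]],
      [forall x, forall y, Srel c.2 x y == Srel c.2 y x] &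
      [forall x, forall y, forall z, ~~ [&& Srel c.2 x y, Srel c.2 y z & Srel c.2 x z]]].
pose Ext c := if ok c then [set g | extends (blowup c.1) (Srel c.2) g] else set0.
have ext8 c : #|Ext c| ^ 8 <= 2 ^ (n * n + 8).
  rewrite /Ext; case: ifP => [/and4P[h1 h2 h3 h4]|_]; last by rewrite cards0 exp0n.
  have sym (B : rel 'I_n) : [forall x, forall y, B x y == B y x] -> symmetric B.
    by move=> h x y; apply/eqP; move/forallP/(_ x)/forallP: h.
  have tf (B : rel 'I_n) : [forall x, forall y, forall z, ~~ [&& B x y, B y z & B x z]] ->
     forall x y z, B x y -> B y z -> ~~ B x z.
    by move=> h x y z xy yz; move/forallP/(_ x)/forallP/(_ y)/forallP/(_ z): h; rewrite xy yz.
  by apply: card_extends; [apply: sym|apply: tf|apply: sym|apply: tf].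
have cover : [set g : graph n | maximal_triangle_free g] \subset
    \bigcup_(c in setX [set: T] Sm) Ext c.
  apply/subsetP => g; rewrite inE => mg.
  have /and3P[/simpleP[irr sym] /triangle_freeP tf _] := mg.
  have [f [R [Asym Atf few]]] := KP _ (adj g) sym tf.
  pose t : T := ([ffun x => f x], R).
  have tE x y : blowup t x y = ((f x, f y) \in R) by rewrite /blowup !ffunE.
  pose X := [set p : 'I_n * 'I_n | adj g p.1 p.2 & (f p.1, f p.2) \notin R].
  have XE x y : Srel X x y = adj g x y && ((f x, f y) \notin R) by rewrite /Srel inE.
  apply/bigcupP; exists (t, X).
    rewrite !inE /= /m leq_divRL ?muln_gt0 ?q0 //.
    rewrite -(ler_nat rat) -[in leRHS](card_ord n) natrM.
    rewrite -ler_pdivlMr ?ltr0n ?muln_gt0 ?q0 //; apply: le_trans few _.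
    rewrite mulrC ler_wpM2l ?ler0n // /eps natrM invfM mulrA divff ?mul1r //.
  have okX : ok (t, X).
    apply/and4P; split; do 2![apply/forallP => ?]; try (apply/forallP => z).
    - by rewrite !tE Asym.
    - by rewrite !tE; apply/negP => /and3P[xy yz]; apply/negP; apply: Atf xy yz.
    - by rewrite !XE sym Asym.
    - rewrite !XE; apply/negP => /and3P[/andP[xy _] /andP[yz _] /andP[xz _]].
      by have := tf _ _ _ xy yz; rewrite xz.
  rewrite /Ext okX inE /extends mg /=.
  by apply/forallP => x; apply/forallP => y; rewrite XE tE.
have {cover} le1 : num_mtf n <= \sum_(c in setX [set: T] Sm) #|Ext c|.
  apply: leq_trans (subset_leq_card cover) _.
  elim/big_rec2: _ => [|c k B _ IH]; first by rewrite cards0.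
  apply: leq_trans (leq_add (leqnn _) IH).
  by rewrite cardsU leq_subr.
(* The eighth-power bound holds for each single [Ext c], so the sum is first replaced by its number
   of terms times the maximum. *)
pose B := \max_(c : T * {set 'I_n * 'I_n}) #|Ext c|.
have B8 : B ^ 8 <= 2 ^ (n * n + 8).
  rewrite /B; elim/big_ind: _ => [|a b a8 b8|c _]; [by rewrite exp0n| |exact: ext8].
  by rewrite /maxn; case: ifP.
have {}le1 : num_mtf n <= #|{: T}| * #|Sm| * B.
  apply: leq_trans le1 _; rewrite -cardsT -cardsX -sum_nat_const.
  by apply: leq_sum => c _; apply: leq_bigmax.
have cT : #|{: T}| = K ^ n * 2 ^ (K * K).
  rewrite card_prod card_ffun !card_ord; congr (_ * _).
  by rewrite -cardsT -powersetT card_powerset cardsT card_prod card_ord.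
rewrite -cT -!expnMn.
apply: (@leq_trans ((#|{: T}| * #|Sm| * B) ^ 8)); first by rewrite leq_exp2r.
by rewrite !expnMn leq_mul2l B8 orbT.
Qed.

(** The exponents are n^2 for the blow-ups, 16n^2 for S and q(n^2 + 8) for the extensions, at most
    (q + 18)n^2 for large n; 25 leaves slack. *)
Lemma num_mtf_root (q : nat) : 0 < q ->
  exists N : nat, forall n, N <= n -> num_mtf n ^ (8 * q) <= 2 ^ ((q + 25) * (n * n)).
Proof.
move=> q0; have [K KP] := num_mtf_le q0.
exists (8 * q * (K + K * K) + 8 * q) => n Nn; have [s [sq le8]] := KP n.
rewrite expnM; apply: (@leq_trans (((K ^ n * 2 ^ (K * K)) ^ 8 * s ^ 8 * 2 ^ (n * n + 8)) ^ q)).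
  by rewrite leq_exp2r.
have a1 : K ^ n * 2 ^ (K * K) <= 2 ^ (K * n + K * K).
  by rewrite expnD leq_mul // expnM leq_expn2r // ltnW // ltn_expl.
have {}a1 : (K ^ n * 2 ^ (K * K)) ^ (8 * q) <= 2 ^ (n * n).
  apply: leq_trans (leq_expn2r _ a1) _; rewrite -expnM leq_pexp2l //.
  nia.
have {}sq : s ^ (8 * q) <= 2 ^ (16 * (n * n)).
  rewrite [8 * q]mulnC expnM; apply: leq_trans (leq_expn2r 8 sq) _.
  by rewrite -expnM leq_pexp2l //; lia.
move: a1; set a := K ^ n * _ => a1.
rewrite 2!expnMn -!(expnM _ 8 q) -(expnM 2 _ q).
apply: leq_trans (leq_mul (leq_mul a1 sq) (leqnn _)) _.
have nq : 8 * q <= n * n.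
  have: 8 * q <= n by apply: leq_trans Nn; rewrite leq_addl.
  by move/leq_trans; apply; case: (n) => // k; rewrite leq_pmulr.
rewrite -(expnD 2 (n * n)) -expnD leq_exp2l // !mulnDl.
by move: (n * n) nq => m nq; rewrite [m * q]mulnC; lia.
Qed.

(* Passage to real exponents *)
From Stdlib Require Import Reals Lra.
Open Scope R_scope.

Lemma INR_expn (a b : nat) : INR (expn a b) = INR a ^ b.
Proof. by elim: b => [|b IH] //; rewrite expnS -multE mult_INR IH. Qed.

Lemma ln_num_mtf_le (q : nat) : lt 0 q ->
  exists N : nat, forall n, le N n -> leq 1 (num_mtf n) ->
    ln (INR (num_mtf n)) / ln 2 - INR n ^ 2 / 8 <= 25 / (8 * INR q) * INR n ^ 2.
Proof.
move=> q0; have [|N NP] := @num_mtf_root q; first by apply/ssrnat.ltP.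
exists N => n /ssrnat.leP/NP le pos.
have ln2 : 0 < ln 2 by rewrite -ln_1; apply: ln_increasing; Lra.lra.
have qR : 0 < INR q by apply: lt_0_INR.
have mR : 0 < INR (num_mtf n) by apply/lt_0_INR/ssrnat.ltP.
have {le} : 8 * INR q * ln (INR (num_mtf n)) <= (INR q + 25) * INR n ^ 2 * ln 2.
  have := le_INR _ _ (elimT ssrnat.leP le); rewrite !INR_expn => leR.
  have : ln (INR (num_mtf n) ^ muln 8 q) <= ln (INR 2 ^ muln (addn q 25) (muln n n)).
    by case: leR => [lt|->]; [left; apply: ln_increasing => //; apply: pow_lt | right].
  rewrite !ln_pow //; last by rewrite /=; Lra.lra.
  rewrite -!multE -plusE !mult_INR plus_INR.
  have IZ k : INR k = IZR (Z.of_nat k) by apply: INR_IZR_INZ.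
  rewrite (IZ 8%nat) (IZ 25%nat) (IZ 2%nat) /= => leln.
  by Lra.lra.
move=> h; apply: (Rmult_le_reg_r (8 * INR q * ln 2)); first by Lra.nra.
have -> : 25 / (8 * INR q) * INR n ^ 2 * (8 * INR q * ln 2) = 25 * INR n ^ 2 * ln 2.
  by field; Lra.lra.
have -> : (ln (INR (num_mtf n)) / ln 2 - INR n ^ 2 / 8) * (8 * INR q * ln 2) =
   8 * INR q * ln (INR (num_mtf n)) - INR n ^ 2 * INR q * ln 2.
  by field; Lra.lra.
by Lra.nra.
Qed.

Theorem theorem1 :
  exists g : nat -> R,
    Un_cv (fun n => g n / (INR n ^ 2)) 0 /\
    forall n : nat, INR (num_mtf n) <= Rpower 2 (INR n ^ 2 / 8 + g n).
Proof.
have ln2 : 0 < ln 2 by rewrite -ln_1; apply: ln_increasing; Lra.lra.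
(* The maximum with 0 makes [g] nonnegative, so the limit needs an upper bound only; the case of a
   zero count keeps the logarithm to positive arguments. *)
pose g n := if num_mtf n is O then 0
            else Rmax 0 (ln (INR (num_mtf n)) / ln 2 - INR n ^ 2 / 8).
exists g; split=> [eps eps0|n]; last first.
  case: (posnP (num_mtf n)) => [->|pos]; first by left; apply: exp_pos.
  have mR : 0 < INR (num_mtf n) by apply/lt_0_INR/ssrnat.ltP.
  have gn : ln (INR (num_mtf n)) / ln 2 <= INR n ^ 2 / 8 + g n.
    rewrite /g; case: (num_mtf n) pos => // k _.
    by have := Rmax_r 0 (ln (INR k.+1) / ln 2 - INR n ^ 2 / 8); Lra.lra.
  rewrite -{1}(exp_ln _ mR) /Rpower.
  have [lt|->] : ln (INR (num_mtf n)) <= (INR n ^ 2 / 8 + g n) * ln 2.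
  - by have := Rmult_le_compat_r (ln 2) _ _ (Rlt_le _ _ ln2) gn;
      rewrite /Rdiv Rmult_assoc Rinv_l; Lra.lra.
  - by left; apply: exp_increasing.
  - by right.
have [q qP] := INR_unbounded (25 / (8 * eps) + 1).
have e1 : 0 < 25 / (8 * eps) by apply: Rdiv_lt_0_compat; Lra.lra.
have q0 : lt 0 q by apply: INR_lt; rewrite /=; Lra.lra.
have [N NP] := ln_num_mtf_le q0.
(* The successor ensures n > 0, hence a nonzero n^2 to divide by. *)
exists N.+1 => n Nn.
have n0 : 0 < INR n by apply: lt_0_INR; lia.
have n2 : 0 < INR n ^ 2 by apply: pow_lt.
have g0 : 0 <= g n by rewrite /g; case: (num_mtf n) => [|k]; [Lra.lra|apply: Rmax_l].
have b0 : 25 / (8 * INR q) < eps.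
  apply: (Rmult_lt_reg_r (8 * INR q)); first Lra.lra.
  have -> : 25 / (8 * INR q) * (8 * INR q) = 25 by field; Lra.lra.
  have : 25 / (8 * eps) * (8 * eps) = 25 by field; Lra.lra.
  Lra.nra.
have b1 : 0 < 25 / (8 * INR q) by apply: Rdiv_lt_0_compat; Lra.lra.
have gle : g n <= 25 / (8 * INR q) * INR n ^ 2.
  have := NP n; rewrite /g; case: (num_mtf n) => [|k] bnd; first by Lra.nra.
  by apply: Rmax_lub; [Lra.nra | apply: bnd => //; lia].
rewrite /R_dist Rminus_0_r Rabs_right; last first.
  by apply: Rle_ge; apply: Rmult_le_pos => //; left; apply: Rinv_0_lt_compat.
apply: (Rmult_lt_reg_r (INR n ^ 2)) => //.
rewrite /Rdiv Rmult_assoc Rinv_l; last Lra.lra.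
by Lra.nra.
Qed.
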